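(* Let $R$ be an integral domain with $\operatorname{char} R\neq 2$. Let $\mathcal{A}_1$ and $\mathcal{A}_2$ be central real hyperplane arrangements, and suppose that $\mathcal{A}_1$ is generic in codimension $2$. If $\mathrm{VG}(\mathcal{A}_1)_R\simeq \mathrm{VG}(\mathcal{A}_2)_R$ as filtered $R$-algebras, then the tope graphs $\mathrm{Tope}(\mathcal{A}_1)$ and $\mathrm{Tope}(\mathcal{A}_2)$ are isomorphic as graphs.
   Context: A central real arrangement $\mathcal{A}=\{H_1,\dots,H_n\}$ is a finite set of distinct linear hyperplanes in $V=\mathbb{R}^\ell$, $H_i=\alpha_i^{-1}(0)$ with $\alpha_i\in V^*$; write $H_i^+=\alpha_i^{-1}(\mathbb{R}_{>0})$, $H_i^-=\alpha_i^{-1}(\mathbb{R}_{<0})$. Its chambers $\mathrm{ch}(\mathcal{A})$ are the connected components of $V\setminus\bigcup_i H_i$. The Varchenko–Gelfand algebra $\mathrm{VG}(\mathcal{A})_R$ is the $R$-algebra of all functions $\mathrm{ch}(\mathcal{A})\to R$ with pointwise operations. The Heaviside function $x_i^+$ (resp. $x_i^-$) takes value $1$ on chambers contained in $H_i^+$ (resp. $H_i^-$) and $0$ elsewhere. The VG filtration is $\mathrm{Fil}^{-1}=0$ and, for $k\ge 0$, $\mathrm{Fil}^k\mathrm{VG}(\mathcal{A})$ is the set of elements $G(x_1^+,\dots,x_n^+)$ with $G\in R[z_1,\dots,z_n]$ of degree $\le k$. A filtered $R$-algebra isomorphism is an $R$-algebra isomorphism $\varphi$ with $\varphi(\mathrm{Fil}^k)=\mathrm{Fil}^k$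 for all $k$. The tope graph $\mathrm{Tope}(\mathcal{A})$ has vertex set $\mathrm{ch}(\mathcal{A})$, with $C,C'$ adjacent iff exactly one hyperplane of $\mathcal{A}$ separates them. $\mathcal{A}$ is generic in codimension $2$ if every codimension-$2$ subspace of $V$ that is an intersection of hyperplanes of $\mathcal{A}$ is contained in exactly two hyperplanes of $\mathcal{A}$. *)

(* Defs.v *)
From mathcomp Require Import all_boot all_order all_algebra.
From mathcomp Require Import all_classical all_reals all_analysis.
(* Notations are left out: those of mpoly clash with those of analysis. *)
From mathcomp Require Import (canonicals, coercions) mpoly.

Set Implicit Arguments.
Unset Strict Implicit.
Unset Printing Implicit Defensive.

Import Order.TTheory GRing.Theory Num.Theory.
Import numFieldNormedType.Exports.

Local Open Scope classical_set_scope.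
Local Open Scope ring_scope.

(* The defining forms [form i] are part of the data, since they fix the sides
   of each hyperplane. *)
Record arrangement (F : realType) (l : nat) := Arrangement {
  nhyp : nat;
  form : 'I_nhyp -> 'Hom('rV[F]_l, F^o);
  form_neq0 : forall i, form i != 0;
  hyp_inj : injective (fun i => lker (form i))
}.

Section Arrangement.
Context {F : realType} {l : nat}.
Implicit Types A : arrangement F l.

Definition hyp A (i : 'I_(nhyp A)) : {vspace 'rV[F]_l} := lker (form i).

Definition pos_side A (i : 'I_(nhyp A)) : set 'rV[F]_l :=
  [set v | (0 : F) < form i v].

Definition neg_side A (i : 'I_(nhyp A)) : set 'rV[F]_l :=
  [set v | form i v < (0 : F)].

Definition arr_compl A : set 'rV[F]_l :=
  [set v | forall i : 'I_(nhyp A), v \notin hyp i].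

Definition chambers A : set (set 'rV[F]_l) :=
  connected_component (arr_compl A) @` arr_compl A.

Definition ch A : Type := set_type (chambers A).

Definition generic_codim2 A : Prop :=
  forall X : {vspace 'rV[F]_l},
    (exists S : {set 'I_(nhyp A)}, X = (\bigcap_(i in S) hyp i)%VS) ->
    (\dim X + 2 = l)%N ->
    #|[pred i : 'I_(nhyp A) | (X <= hyp i)%VS]| = 2%N.

Definition separates A (i : 'I_(nhyp A)) (C D : ch A) : Prop :=
  (val C `<=` pos_side i /\ val D `<=` neg_side i) \/
  (val C `<=` neg_side i /\ val D `<=` pos_side i).

Definition tope_adj A (C D : ch A) : Prop :=
  exists! i : 'I_(nhyp A), separates i C D.

(* [R^o] is R as a module over itself; the pointwise ring and R-module
   structures are the library's instances on [ch A -> R^o]. *)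
Definition VG A (R : idomainType) : Type := ch A -> R^o.

Definition heaviside A (R : idomainType) (i : 'I_(nhyp A)) : VG A R :=
  fun C => if `[< val C `<=` pos_side i >] then 1 else 0.

(* Since operations in [VG A R] are pointwise, G(x_1^+, ..., x_n^+) is the
   function that evaluates G at the values of the x_i^+ on each chamber.
   [mpoly.msize G] is 1 + the total degree of G (0 for G = 0).
   Negative indices give the zero module. *)
Definition Fil A (R : idomainType) (k : int) : set (VG A R) :=
  match k with
  | Posz d => [set f | exists2 G : mpoly.mpoly (nhyp A) R,
      (mpoly.msize G <= d.+1)%N &
      f = fun C => mpoly.meval (fun i => heaviside R i C : R) G]
  | Negz _ => [set 0]
  end.

End Arrangement.

Definition filtered_alg_iso (F : realType) (l1 l2 : nat)
    (A1 : arrangement F l1) (A2 : arrangement F l2) (R : idomainType)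
    (phi : VG A1 R -> VG A2 R) : Prop :=
  [/\ linear phi, monoid_morphism phi, bijective phi &
      forall k : int, phi @` Fil k = Fil k].

Definition tope_iso (F : realType) (l1 l2 : nat)
    (A1 : arrangement F l1) (A2 : arrangement F l2)
    (f : ch A1 -> ch A2) : Prop :=
  bijective f /\ forall C D : ch A1, tope_adj C D <-> tope_adj (f C) (f D).

(* Main.v *)
(** An algebra isomorphism between rings of functions with values in a domain
    is composition with a bijection [sigma] of the chambers.  An element of
    [Fil 1] is an affine combination of Heaviside functions; its coefficient at
    [H_i] is the jump across [H_i].  When the arrangement is generic in
    codimension 2, any two hyperplanes meet in a point off all the others, and
    the four chambers around it show that a 0/1-valued element of [Fil 1]
    cannot jump across both (as 2 <> 0): if it is not constant, it separates the
    same chambers as a single hyperplane.  Pulling back the Heaviside functions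
    of [A2] thus sends each hyperplane of [A2] to one of [A1] that separates
    corresponding chambers.  Pairs of chambers separated by exactly one
    hyperplane show that this map of hyperplanes is bijective, so [sigma]
    preserves the number of separating hyperplanes. *)
Require Import Defs.
From mathcomp Require Import all_boot all_order all_algebra.
From mathcomp Require Import all_classical all_reals all_analysis.
From mathcomp Require Import (canonicals, coercions) mpoly.
From mathcomp Require Import ring lra.
Set Implicit Arguments.
Unset Strict Implicit.
Unset Printing Implicit Defensive.

(* [Defs] is imported again because all_analysis has another [form]. *)
Import Defs Order.TTheory GRing.Theory Num.Theory.
Import numFieldNormedType.Exports.
Local Open Scope classical_set_scope.
Local Open Scope ring_scope.

(** * Linear forms: small perturbations, general position, kernels *)

Section GeneralPosition.
Context {F : realFieldType} {vT : vectType F}.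
Implicit Types (f g : 'Hom(vT, F^o)) (s : seq 'Hom(vT, F^o)) (v u w : vT).

Lemma sgr_perturb (x y : F) : `|y| < `|x| -> Num.sg (x + y) = Num.sg x.
Proof.
rewrite ltr_norml; case: (ltrgt0P x) => [x0|x0|->]; last 2 first.
- by move=> /andP[h1 h2]; rewrite !ltr0_sg //; lra.
- by move=> /andP[]; lra.
by move=> /andP[h1 h2]; rewrite !gtr0_sg //; lra.
Qed.

(** Finitely many strict inequalities at [v] survive small moves, so one bound [e] serves all of
    [s]. Two directions are allowed in order to reach the four chambers around a codimension 2
    intersection. *)
Lemma sgr_linear_stable s v u w : exists2 e : F, 0 < e &
  forall f, f \in s -> f v != 0 -> forall a b, `|a| <= e -> `|b| <= e ->
  Num.sg (f (v + a *: u + b *: w) : F) = Num.sg (f v : F).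
Proof.
elim: s => [|g s [e e0 IH]]; first by exists 1.
have M0 : 0 < `|g u : F| + `|g w : F| + 1 by rewrite ltr_wpDl// addr_ge0.
(* The perturbation of [g v] is at most [e1 * (|g u| + |g w|)]; the [+ 1] makes this strictly less
   than [|g v|] and the denominator positive. If [g v = 0] nothing is claimed about [g], and 1 is
   just some positive number. *)
pose e1 := if g v == 0 then 1 else `|g v : F| / (`|g u : F| + `|g w : F| + 1).
have e10 : 0 < e1.
  by rewrite /e1; case: eqVneq => // gv; rewrite divr_gt0// normr_gt0.
exists (Num.min e e1); first by rewrite lt_min e0 e10.
move=> f; rewrite inE => /orP[/eqP-> gv|fs fv] a b; rewrite !le_min; last first.
  by move=> /andP[ae _] /andP[be _]; exact: IH.
move=> /andP[_ ae] /andP[_ be].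
rewrite !linearD !linearZ /= -addrA sgr_perturb//.
apply: (@le_lt_trans _ _ (e1 * (`|g u : F| + `|g w : F|))).
  rewrite mulrDr (le_trans (ler_normD _ _))// lerD//.
    by rewrite normrM ler_wpM2r.
  by rewrite normrM ler_wpM2r.
rewrite {1}/e1 (negbTE gv) mulrAC ltr_pdivrMr// ltr_pM2l ?normr_gt0//.
by rewrite ltrDl.
Qed.

(** A subspace over an ordered field is not a finite union of proper subspaces: if the point found
    for [s] lies in the kernel of [g], a small step along some [u] with [g u != 0] leaves it and
    keeps the other forms nonzero. *)
Lemma avoid_kernels s (X : {vspace vT}) :
  (forall f, f \in s -> ~~ (X <= lker f)%VS) ->
  exists2 v, v \in X & forall f, f \in s -> f v != 0.
Proof.
elim: s => [|g s IH] h; first by exists 0; rewrite ?mem0v.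
have [v vX vs] := IH (fun f fs => h f (mem_behead (s := g :: s) fs)).
have [gv|gv] := eqVneq (g v) 0; last first.
  by exists v => // f; rewrite inE => /orP[/eqP->|/vs].
have /subvPn[u uX] := h g (mem_head _ _); rewrite memv_ker => gu.
have [e e0 he] := sgr_linear_stable s v u 0.
exists (v + e *: u); first by rewrite memvD// memvZ.
move=> f; rewrite inE => /orP[/eqP->|fs].
  by rewrite linearD linearZ/= gv add0r scaler_eq0 negb_or gt_eqF.
have := he f fs (vs f fs) e 0; rewrite scale0r addr0 normr0 gtr0_norm//.
by move=> /(_ (lexx _) (ltW e0)) efs; rewrite -sgr_eq0 efs sgr_eq0 vs.
Qed.

Lemma functional_eq1 f (X : {vspace vT}) : ~~ (X <= lker f)%VS ->
  exists2 u, u \in X & f u = 1 :> F.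
Proof.
move=> /subvPn[u uX]; rewrite memv_ker => fu.
exists ((f u : F)^-1 *: u); first exact: memvZ.
by rewrite linearZ; exact: mulVf.
Qed.

(** Rank-nullity: the image of [X] is a nonzero subspace of a line. *)
Lemma dim_cap_lker f (X : {vspace vT}) : ~~ (X <= lker f)%VS ->
  (\dim (X :&: lker f)).+1 = \dim X.
Proof.
move=> Xf; rewrite -(limg_ker_dim f X); have := dimvS (subvf (f @: X)).
rewrite [\dim (@fullv _ F^o)]dimvf /= => d1.
have d0 : (0 < \dim (f @: X))%N by rewrite lt0n dimv_eq0 -lkerE.
have -> : \dim (f @: X) = 1%N by apply/eqP; rewrite eqn_leq d1 d0.
by rewrite addn1.
Qed.

Lemma fullv_lker f : f != 0 -> ~~ (fullv <= lker f)%VS.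
Proof.
apply: contra => /subvP hf; apply/eqP/lfunP => x; rewrite lfunE.
by apply/eqP; rewrite -memv_ker hf// memvf.
Qed.

Lemma dim_lker f : f != 0 -> (\dim (lker f)).+1 = dim vT.
Proof. by move=> /fullv_lker/dim_cap_lker; rewrite capfv dimvf. Qed.

Lemma lker_functional_sub f g : f != 0 -> g != 0 -> (lker f <= lker g)%VS ->
  lker f = lker g.
Proof.
move=> f0 g0 fg; apply/eqP; rewrite eqEdim fg/=.
by rewrite -ltnS !dim_lker.
Qed.

End GeneralPosition.

(** * Continuity of linear forms and of parametrized lines *)

Lemma continuous_functional {F : realType} {l : nat} (f : 'Hom('rV[F]_l, F^o)) :
  continuous (f : 'rV[F]_l -> F).
Proof.
have -> : (f : 'rV[F]_l -> F) = fun v => \sum_(j < l) v 0 j * (f ('e_j) : F).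
  apply/funext => v; rewrite {1}(row_sum_delta v) linear_sum.
  by apply: eq_bigr => j _; rewrite linearZ.
elim: (index_enum _) => [|j r IH].
  rewrite (_ : (fun v => _) = cst 0); first exact: cst_continuous.
  by apply/funext => v; rewrite big_nil.
rewrite (_ : (fun v => _) = fun v : 'rV[F]_l =>
    v 0 j * (f 'e_j : F) + \sum_(k <- r) v 0 k * (f 'e_k : F)); last first.
  by apply/funext => v; rewrite big_cons.
move=> v; pose c : F := f 'e_j.
have cM := @continuousM F 'rV[F]_l (fun v => v 0 j) (cst c) v
  (@coord_continuous F 1 l 0 j v) (@cst_continuous _ _ _ _).
exact (continuousD cM (IH v)).
Qed.

Lemma continuous_line {F : realType} {l : nat} (v u : 'rV[F]_l) :
  continuous (fun t : F => v + t *: u).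
Proof.
by move=> t; apply: cvgD; [exact: cvg_cst|exact: scalel_continuous].
Qed.

(** * Chambers as sign vectors *)

Section Chambers.
Context {F : realType} {l : nat}.
Implicit Types (A : arrangement F l).

Definition pos A (i : 'I_(nhyp A)) (C : ch A) : bool :=
  `[< val C `<=` pos_side i >].

Lemma arr_complP A v : arr_compl A v <-> forall i : 'I_(nhyp A), form i v != 0.
Proof. by split=> h i; have := h i; rewrite memv_ker. Qed.

Lemma sgr_neq0_eq (x y : F) : x != 0 -> y != 0 -> (0 < x) = (0 < y) ->
  Num.sg x = Num.sg y.
Proof. by case: (sgrP x) => //; case: (sgrP y). Qed.

(** A form maps a connected part of the complement onto an interval missing 0, so its sign is
    constant there. Conversely, the segment joining two points with equal signs stays in the
    complement. *)
Lemma component_sign A v : arr_compl A v ->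
  connected_component (arr_compl A) v =
  [set w | forall i : 'I_(nhyp A), Num.sg (form i w : F) = Num.sg (form i v : F)].
Proof.
move=> vA; have v0 := (arr_complP A v).1 vA.
apply/seteqP; split=> [w [K [Kv KA cK] Kw]|w wv] /=.
  move=> i.
  have K0 u : K u -> form i u != 0 by move=> /KA /arr_complP.
  have : is_interval [set (form i u : F) | u in K].
    apply/connected_intervalP/connected_continuous_connected => //.
    exact/continuous_subspaceT/continuous_functional.
  move=> /[dup] /(_ (form i w) (form i v)) I1 /(_ (form i v) (form i w)) I2.
  apply: sgr_neq0_eq; [exact: K0|exact: K0|].
  have [|w0] := ltrP 0 (form i w : F); have [|v0'] := ltrP 0 (form i v : F) => //.
    move=> /ltW w0; have [|||u Ku u0] := I2 _ _ 0.
    - by exists v.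
    - by exists w.
    - by rewrite v0' w0.
    by have := K0 u Ku; rewrite u0 eqxx.
  move=> /ltW v1; have [|||u Ku u0] := I1 _ _ 0.
  - by exists w.
  - by exists v.
  - by rewrite v1 w0.
  by have := K0 u Ku; rewrite u0 eqxx.
have conv (t : F) : 0 <= t <= 1 ->
    forall i : 'I_(nhyp A), form i (v + t *: (w - v)) != 0.
  move=> /andP[t0 t1] i; rewrite linearD linearZ/= linearB/=.
  have := v0 i; have := wv i.
  move: (form i w : F) (form i v : F) => x y.
  rewrite (_ : y + _ = (1 - t) * y + t * x); last first.
    by rewrite /GRing.scale/=; ring.
  case: (sgrP y) => // y0 /eqP; rewrite ?sgr_cp0 => x0 _.
    apply/eqP => e; suff : 0 < (1 - t) * y + t * x by rewrite e ltxx.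
    (* At [t = 1] only [x] remains; otherwise [(1 - t) * y] is already strictly positive. *)
    have [->|tn] := eqVneq t 1; first by rewrite subrr mul0r add0r mul1r.
    have t1' : 0 < 1 - t by rewrite subr_gt0 lt_neqAle tn.
    by rewrite ltr_wpDr ?mulr_gt0// mulr_ge0// ltW.
  apply/eqP => e; suff : (1 - t) * y + t * x < 0 by rewrite e ltxx.
  have [->|tn] := eqVneq t 1; first by rewrite subrr mul0r add0r mul1r.
  have t1' : 0 < 1 - t by rewrite subr_gt0 lt_neqAle tn.
  by rewrite ltr_wnDr ?nmulr_llt0// ?pmulr_rlt0// mulr_ge0_le0// ltW.
have cseg : connected [set v + t *: (w - v) | t in `[(0 : F), 1]].
  apply: connected_continuous_connected; first exact: segment_connected.
  exact/continuous_subspaceT/continuous_line.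
apply: (connected_component_max _ _ cseg).
- by exists 0; rewrite /= ?in_itv/= ?lexx ?ler01// scale0r addr0.
- by move=> _ [t t01 <-]; apply/arr_complP/conv; rewrite /= in_itv in t01.
- by exists 1; rewrite /= ?in_itv/= ?lexx ?ler01// scale1r addrC subrK.
Qed.

Lemma chamber_point A (C : ch A) : exists2 v, val C v &
  arr_compl A v /\ val C =
  [set w | forall i : 'I_(nhyp A), Num.sg (form i w : F) = Num.sg (form i v : F)].
Proof.
case: C => K /= KA; have /set_mem[v vA <-] := KA.
by exists v; [exact: connected_component_refl|rewrite component_sign].
Qed.

Lemma chamber_of A v : arr_compl A v -> exists C : ch A, val C v.
Proof.
move=> vA; have KA : connected_component (arr_compl A) v \in chambers A.
  by rewrite inE; exists v.
by exists (exist (fun K => K \in chambers A) _ KA); exact: connected_component_refl.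
Qed.

Lemma posE A (C : ch A) v i : val C v -> pos i C = (0 < (form i v : F)).
Proof.
have [u _ [_ Cu]] := chamber_point C.
rewrite /pos Cu => /= uv; apply/asboolP/idP => [|vi w wu].
  by move=> /(_ v uv).
by rewrite /pos_side/= -sgr_gt0 wu -uv sgr_gt0.
Qed.

Lemma pos_inj A (C D : ch A) : (forall i, pos i C = pos i D) -> C = D.
Proof.
have [v vC [/arr_complP v0 Cv]] := chamber_point C.
have [w wD [/arr_complP w0 Dw]] := chamber_point D.
move=> CD; apply/val_inj; rewrite Cv Dw.
have vw (i : 'I_(nhyp A)) : Num.sg (form i v : F) = Num.sg (form i w : F).
  by apply: sgr_neq0_eq => //; rewrite -(posE i vC) CD (posE i wD).
by apply/seteqP; split=> u /= + i => /(_ i) ->.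
Qed.

Lemma negE A (C : ch A) i : val C `<=` neg_side i <-> ~~ pos i C.
Proof.
have [v vC [/arr_complP v0 Cv]] := chamber_point C.
rewrite (posE i vC) -leNgt; split => [/(_ v vC)/ltW //|vi w].
by rewrite Cv /neg_side/= -sgr_lt0 => ->; rewrite sgr_lt0 lt_neqAle v0.
Qed.

Lemma separatesE A (C D : ch A) i : separates i C D <-> pos i C != pos i D.
Proof.
rewrite /separates !negE; split.
  by move=> [[/asboolP + ]|[+ /asboolP]]; rewrite -/(pos _ _) => /[swap];
    [move=> /negbTE -> -> | move=> -> /negbTE ->].
rewrite /pos; case: asboolP => [?|_]; case: asboolP => [?|_] //= _.
  by left.
by right.
Qed.

Lemma heavisideE A (R : idomainType) (i : 'I_(nhyp A)) (C : ch A) :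
  heaviside R i C = (pos i C)%:R.
Proof. by rewrite /heaviside /pos; case: asboolP. Qed.

(** * Chambers around a generic point of a hyperplane or of a codimension 2 intersection *)

Lemma form_avoid A (X : {vspace 'rV[F]_l}) (P : pred 'I_(nhyp A)) :
  (forall k, P k -> ~~ (X <= lker (form k))%VS) ->
  exists2 v, v \in X & forall k, P k -> form k v != 0.
Proof.
move=> h; have [|v vX vP] := @avoid_kernels _ _ [seq form k | k in P] X.
  by move=> _ /fintype.imageP[k Pk ->]; exact: h.
by exists v => // k Pk; apply: vP; exact: fintype.image_f.
Qed.

Lemma form_stable A (v u w : 'rV[F]_l) : exists2 e : F, 0 < e &
  forall (k : 'I_(nhyp A)) (a b : bool), form k v != 0 ->
  Num.sg (form k (v + ((-1) ^+ a * e) *: u + ((-1) ^+ b * e) *: w) : F) =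
  Num.sg (form k v : F).
Proof.
have [e e0 he] := sgr_linear_stable [seq form k | k : 'I_(nhyp A)] v u w.
exists e => // k a b kv; apply: he => //; first exact: fintype.image_f.
  by rewrite normrMsign gtr0_norm.
by rewrite normrMsign gtr0_norm.
Qed.

Lemma hyp_not_sub A (i k : 'I_(nhyp A)) : k != i ->
  ~~ (lker (form i) <= lker (form k))%VS.
Proof.
apply: contraNN => /(lker_functional_sub (form_neq0 i) (form_neq0 k)) ik.
by apply/eqP/esym; exact: (@hyp_inj _ _ A).
Qed.

Lemma signM_gt0 (e : F) (b : bool) : 0 < e -> (0 < (-1) ^+ (~~ b) * e) = b.
Proof.
case: b => e0; rewrite /= ?mul1r ?mulN1r ?expr0 ?expr1 ?mul1r ?mulN1r//.
by rewrite oppr_gt0 ltNge ltW.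
Qed.

(** From a point of [H_i] off all other hyperplanes, small steps along [u] and [-u], with
    [form i u = 1], cross [H_i] only. *)
Lemma wall A (i : 'I_(nhyp A)) :
  exists C D : ch A, forall k, (pos k C != pos k D) = (k == i).
Proof.
have [v vi vk] := form_avoid (fun k => @hyp_not_sub A i k).
have [u _ ui] := functional_eq1 (fullv_lker (form_neq0 i)).
have [e e0 he] := @form_stable A v u 0.
(* The negation in the exponent makes [true] the positive side. *)
pose p (a : bool) := v + ((-1) ^+ (~~ a) * e) *: u.
have pE a k : k != i -> Num.sg (form k (p a) : F) = Num.sg (form k v : F).
  by move=> /vk /he - /(_ (~~ a) false); rewrite scaler0 addr0.
have pi a : form i (p a) = (-1) ^+ (~~ a) * e :> F.
  have : form i v = 0 by apply/eqP; rewrite -memv_ker.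
  rewrite /p linearD linearZ/= => ->; rewrite add0r ui.
  by rewrite /GRing.scale/= mulr1.
have pA a : arr_compl A (p a).
  apply/arr_complP => k; have [->|ki] := eqVneq k i.
    by rewrite pi mulf_neq0 ?signr_eq0// gt_eqF.
  by rewrite -sgr_eq0 pE// sgr_eq0 vk.
have [C Cp] := chamber_of (pA true); have [D Dp] := chamber_of (pA false).
exists C, D => k; rewrite (posE k Cp) (posE k Dp).
have [->|ki] := eqVneq k i; first by rewrite !pi !signM_gt0.
rewrite -(sgr_gt0 (form k (p true) : F)) -(sgr_gt0 (form k (p false) : F)).
by rewrite !pE// eqxx.
Qed.

(** Two distinct hyperplanes meet in codimension 2, so a third one through the intersection would
    contradict genericity. *)
Lemma generic_not_sub A (i j k : 'I_(nhyp A)) : generic_codim2 A ->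
  i != j -> k != i -> k != j ->
  ~~ (lker (form i) :&: lker (form j) <= lker (form k))%VS.
Proof.
move=> gen ij ki kj; apply/negP => Xk.
pose X := (lker (form i) :&: lker (form j))%VS.
have X_int : exists S : {set 'I_(nhyp A)}, X = (\bigcap_(a in S) hyp a)%VS.
  by exists [set i; j]%SET; rewrite big_setU1 ?inE//= big_set1.
have X_dim : (\dim X + 2 = l)%N.
  have := dim_lker (form_neq0 i).
  rewrite -(dim_cap_lker (hyp_not_sub (i := i) (k := j) _)) 1?eq_sym//.
  by rewrite addn2 => ->; rewrite /dim/= mul1n.
have E2 := gen X X_int X_dim.
have : ([set i; j; k]%SET \subset
    [pred a | (X <= hyp a)%VS]).
  apply/fintype.subsetP => a; rewrite !inE => /orP[/orP[]|] /eqP->.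
  - exact: capvSl.
  - exact: capvSr.
  - exact: Xk.
move=> /subset_leq_card; rewrite E2.
by rewrite finset.setUC cardsU1 cards2 !inE ij (negbTE ki) (negbTE kj).
Qed.

(** Start at a point of [H_i] and [H_j] off all the others. Moving along [u] in [H_j] and [w] in
    [H_i] changes the signs of [form i] and [form j] independently and fixes the rest. *)
Lemma codim2_square A (i j : 'I_(nhyp A)) : generic_codim2 A -> i != j ->
  exists C : bool -> bool -> ch A, forall a b,
  [/\ pos i (C a b) = a, pos j (C a b) = b &
    forall k, k != i -> k != j -> pos k (C a b) = pos k (C true true)].
Proof.
move=> gen ij; have ji : j != i by rewrite eq_sym.
have [k /andP[ki kj]|v] :=
    @form_avoid A (lker (form i) :&: lker (form j)) [pred k | (k != i) && (k != j)].
  exact: generic_not_sub.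
rewrite memv_cap !memv_ker => /andP[/eqP vi /eqP vj] vk.
have [u uj ui] := functional_eq1 (hyp_not_sub ij).
have [w wi wj] := functional_eq1 (hyp_not_sub ji).
move: uj wi; rewrite !memv_ker => /eqP uj /eqP wi.
have [e e0 he] := @form_stable A v u w.
pose p (a b : bool) := v + ((-1) ^+ (~~ a) * e) *: u + ((-1) ^+ (~~ b) * e) *: w.
have pE a b k : k != i -> k != j ->
    Num.sg (form k (p a b) : F) = Num.sg (form k v : F).
  by move=> ki kj; apply: he; apply: vk; rewrite /= ki.
have pi a b : form i (p a b) = (-1) ^+ (~~ a) * e :> F.
  rewrite /p !linearD !linearZ/= vi add0r ui wi scaler0 addr0.
  by rewrite /GRing.scale/= mulr1.
have pj a b : form j (p a b) = (-1) ^+ (~~ b) * e :> F.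
  rewrite /p !linearD !linearZ/= vj add0r uj wj scaler0 add0r.
  by rewrite /GRing.scale/= mulr1.
have pA a b : arr_compl A (p a b).
  apply/arr_complP => k; have [->|ki] := eqVneq k i.
    by rewrite pi mulf_neq0 ?signr_eq0// gt_eqF.
  have [->|kj] := eqVneq k j.
    by rewrite pj mulf_neq0 ?signr_eq0// gt_eqF.
  by rewrite -sgr_eq0 pE// sgr_eq0; apply: vk; rewrite /= ki.
have /boolp.choice[C Cp] ab := chamber_of (pA ab.1 ab.2).
exists (fun a b => C (a, b)) => a b.
have Cab c d := Cp (c, d).
split; first by rewrite (posE i (Cab a b)) pi signM_gt0.
  by rewrite (posE j (Cab a b)) pj signM_gt0.
move=> k ki kj; rewrite (posE k (Cab a b)) (posE k (Cab true true)).
rewrite -(sgr_gt0 (form k (p a b) : F)) -(sgr_gt0 (form k (p true true) : F)).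
by rewrite !pE.
Qed.

End Chambers.

(** * Algebra morphisms between function rings are evaluations *)

(* Among the orthogonal idempotents [e c], which sum to 1, one does not vanish
   under [phi] at [s]; as [f * e c = f t *: e c], it can be cancelled. *)
Lemma fun_alg_hom_eval (T S : Type) (I : finType) (code : T -> I)
    (R : idomainType) (phi : (T -> R^o) -> (S -> R^o)) :
  injective code -> linear phi -> monoid_morphism phi ->
  forall s, exists t, forall f, phi f s = f t.
Proof.
move=> code_inj lin [phi1 phiM] s.
have phiD u v : phi (u + v) = phi u + phi v.
  by have := lin 1 u v; rewrite !scale1r.
have phi0 : phi 0 = 0.
  by apply: (addrI (phi 0)); rewrite -phiD !addr0.
have phiZ a u : phi (a *: u) = a *: phi u.
  by have := lin a u 0; rewrite phi0 !addr0.
pose e c : T -> R^o := fun t => (code t == c)%:R.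
have e1 : \sum_c e c = 1.
  apply/funext => t; rewrite fct_sumE (bigD1 (code t))//= big1 ?addr0.
    by rewrite /e eqxx.
  by move=> c /negbTE ct; rewrite /e eq_sym ct.
have [c ec] : exists c, phi (e c) s != 0.
  case: (pickP (fun c => phi (e c) s != 0)) => [c ec|e0]; first by exists c.
  have := phi1; rewrite -e1 (big_morph phi phiD phi0) fct_sumE.
  move=> /(congr1 (fun h => h s)); rewrite big1 => [/eqP|c _].
    by rewrite eq_sym oner_eq0.
  by apply/eqP; have := e0 c; case: eqP.
(* An index outside the image of [code] gives [e c = 0], which [phi] would send to 0. *)
have [t tc] : exists t, code t = c.
  apply: contrapT => nt; move: ec; rewrite (_ : e c = 0) ?phi0 ?eqxx//.
  by apply/funext => t; rewrite /e; case: eqP => // tc; case: nt; exists t.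
exists t => f; apply: (mulIf ec).
have fe : f * e c = f t *: e c.
  apply/funext => u; rewrite mulrfctE scalrfctE /e.
  by case: eqP => [uc|_]; [rewrite (code_inj u t)// uc|rewrite mulr0 scaler0].
have := congr1 phi fe; rewrite phiM phiZ => /(congr1 (fun h => h s)).
exact.
Qed.

Lemma natr_bool_inj (R : nzRingType) : injective (fun b : bool => b%:R : R).
Proof.
by case; case=> //= /eqP; rewrite ?oner_eq0// eq_sym oner_eq0.
Qed.

(** * The first filtration step and its 0/1-valued elements *)

Section FirstFiltration.
Context {F : realType} {l : nat} (A : arrangement F l) (R : idomainType).

Lemma Fil1_affine (f : VG A R) : Fil (Posz 1) f ->
  exists c (a : 'I_(nhyp A) -> R), forall C,
    f C = c + \sum_i a i * (pos i C)%:R.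
Proof.
move=> [G szG ->].
suff [c [a ca]] : exists c (a : 'I_(nhyp A) -> R), forall v,
    mpoly.meval v G = c + \sum_i a i * v i.
  exists c, a => C; rewrite ca; congr (_ + _); apply: eq_bigr => i _.
  by rewrite heavisideE.
(* [msize] exceeds the degree by one, so the monomials of [G] are 1 and single variables. *)
have mG m : m \in mpoly.msupp G -> (mpoly.mdeg m < 2)%N.
  by move=> /mpoly.msize_mdeg_lt /leq_trans; exact.
under eq_exists do under eq_exists do under eq_forall do rewrite mpoly.mevalE.
(* The induction shortens only the list of monomials; the coefficients stay those of [G]. *)
elim: (mpoly.msupp G : seq _) mG => [_|m r IH mr].
  exists 0, (fun=> 0) => v; rewrite big_nil big1 ?addr0// => i _.
  by rewrite mul0r.
have [|c [a ca]] := IH; first by move=> k kr; apply: mr; rewrite inE kr orbT.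
have := mr m (mem_head _ _); rewrite ltnS leq_eqVlt ltnS leqn0.
move=> /orP[/mpoly.mdeg1P[i /eqP mi]|].
  exists c, (fun k => a k + (if k == i then mpoly.mcoeff m G else 0)) => v.
  rewrite big_cons ca mi -mpoly.mevalX mpoly.mevalXU addrCA; congr (_ + _).
  under [RHS]eq_bigr do rewrite mulrDl.
  rewrite big_split/= addrC; congr (_ + _).
  rewrite (bigD1 i)//= eqxx big1 ?addr0 ?mi// => k /negbTE->.
  by rewrite mul0r.
rewrite mpoly.mdeg_eq0 => /eqP m0.
exists (mpoly.mcoeff m G + c), a => v; rewrite big_cons ca addrA.
rewrite (_ : \prod_i _ = 1) ?mulr1// big1// => i _.
by rewrite m0 mpoly.mnm0E expr0.
Qed.

Lemma heaviside_Fil1 (i : 'I_(nhyp A)) : Fil (Posz 1) (heaviside R i).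
Proof.
exists (mpoly.mpolyX R (mpoly.mnm1 i)).
  by rewrite mpoly.msizeX mpoly.mdeg1.
by apply/funext => C; rewrite mpoly.mevalXU.
Qed.

(** If [a] and [b] are both nonzero, then [x = 0] forces [a = b = 1] and [x = 1] forces
    [a = b = -1]. The fourth value is then 2 or -1, neither of which is 0 or 1 when 2 is nonzero. *)
Lemma no_boolean_square (x a b : R) : 2%:R != 0 :> R ->
  (forall s t : bool, let y := x + a * s%:R + b * t%:R in y = 0 \/ y = 1) ->
  a = 0 \/ b = 0.
Proof.
move=> /negbTE two; rewrite mulr2n in two.
move=> h; have := h false false; have := h true false.
have := h false true; have := h true true.
rewrite /= !mulr1 !mulr0 !addr0.
have [->|a0] := eqVneq a 0; first by left.
have [->|b0] := eqVneq b 0; first by right.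
move=> h11 h01 h10 [x0|x1].
  have h0 (y : R) : y != 0 -> x + y = 0 \/ x + y = 1 -> y = 1.
    by rewrite x0 add0r => /eqP y0 [].
  move: h11; rewrite (h0 _ b0 h01) (h0 _ a0 h10) x0 add0r => -[/eqP|/eqP].
    by rewrite two.
  by rewrite -subr_eq0 addrK oner_eq0.
have h1 (y : R) : y != 0 -> x + y = 0 \/ x + y = 1 -> y = -1.
  rewrite x1 => y0 [/eqP|/eqP].
    by rewrite addrC addr_eq0 => /eqP.
  by rewrite addrC -subr_eq0 addrK (negbTE y0).
move: h11; rewrite (h1 _ b0 h01) (h1 _ a0 h10) x1 subrr add0r => -[/eqP|/eqP].
  by rewrite oppr_eq0 oner_eq0.
by rewrite eq_sym -subr_eq0 opprK two.
Qed.

(** Nonconstancy gives some [a i != 0]; squares of chambers around [H_i] and [H_j] then kill every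
    other [a j], leaving [c + a i * x_i^+]. *)
Lemma boolean_affine (g : VG A R) c a :
  2%:R != 0 :> R -> generic_codim2 A ->
  (forall C, g C = c + \sum_i a i * (pos i C)%:R) ->
  (forall C, g C = 0 \/ g C = 1) ->
  (exists C D, g C <> g D) ->
  exists i, forall C D, (g C = g D) <-> (pos i C = pos i D).
Proof.
move=> two_neq0 gen ga g01 [C0 [D0 CD0]].
case: (pickP (fun i => a i != 0)) => [i ai|a0]; last first.
  case: CD0; rewrite !ga; congr (_ + _); apply: eq_bigr => i _.
  by have /eqP -> := a0 i; rewrite !mul0r.
have aj j : j != i -> a j = 0.
  move=> ji; have ij : i != j by rewrite eq_sym.
  have [C CE] := codim2_square gen ij.
  (* The part of [g] that is constant on the four chambers. *)
  pose x := c + \sum_(k | (k != i) && (k != j)) a k * (pos k (C true true))%:R.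
  have [s t|/eqP|//] := @no_boolean_square x (a i) (a j) two_neq0.
    have [Ci Cj Ck] := CE s t.
    have <- : g (C s t) = x + a i * s%:R + a j * t%:R; last exact: g01.
    rewrite ga (bigD1 i)//= (bigD1 j)//= Ci Cj /x.
    rewrite (eq_bigr (fun k => a k * (pos k (C true true))%:R)); first by ring.
    by move=> k /andP[ki kj]; rewrite Ck.
  by rewrite (negbTE ai).
have gi C : g C = c + a i * (pos i C)%:R.
  rewrite ga (bigD1 i)//= big1 ?addr0// => j /aj ->.
  by rewrite mul0r.
exists i => C D; rewrite !gi; split=> [/addrI/(mulfI ai)/natr_bool_inj//|->//].
Qed.

End FirstFiltration.

Lemma tope_adjE (F : realType) (l : nat) (A : arrangement F l) (C D : ch A) :
  tope_adj C D <-> exists! i : 'I_(nhyp A), pos i C != pos i D.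
Proof.
by split=> -[i [/separatesE iCD u]]; exists i; split=> // j /separatesE; exact: u.
Qed.

(** * From the algebra isomorphism to a bijection of chambers *)

Section Isomorphism.
Context {F : realType} {R : idomainType} {l1 l2 : nat}.
Context {A1 : arrangement F l1} {A2 : arrangement F l2}.

Lemma filtered_alg_iso_eval (phi : VG A1 R -> VG A2 R) :
  filtered_alg_iso phi ->
  exists2 sigma : ch A2 -> ch A1, bijective sigma &
    forall f, phi f = f \o sigma.
Proof.
move=> [lin mon [psi phiK psiK] _].
(* Sign vectors embed the chambers into a finite type. *)
have code_inj : injective (fun C : ch A1 => [ffun i => pos i C]).
  by move=> C D /ffunP CD; apply: pos_inj => i; have := CD i; rewrite !ffunE.
have /boolp.choice[sigma sE] := fun_alg_hom_eval code_inj lin mon.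
have phiE f : phi f = f \o sigma by apply/funext => D; exact: sE.
exists sigma => //.
(* By surjectivity of [phi], every Heaviside function of [A2] factors through [sigma], and these
   functions separate chambers. *)
have s_inj D D' : sigma D = sigma D' -> D = D'.
  move=> DD'; apply: pos_inj => j; apply: (@natr_bool_inj R) => /=.
  by rewrite -!heavisideE -[heaviside R j]psiK phiE /= DD'.
have /boolp.choice[tau tauK] : forall C, exists D, sigma D = C.
  move=> C; apply: contrapT => nD.
  (* The indicator of a chamber missed by [sigma] would be killed by [phi]. *)
  pose d : VG A1 R := fun C' => `[< C' = C >]%:R.
  have : phi d = phi 0.
    rewrite !phiE; apply/funext => D /=; rewrite /d.
    by case: asboolP => // DC; case: nD; exists D.
  move=> /(can_inj phiK) /(congr1 (fun h => h C)) /eqP.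
  by rewrite /d asboolT// oner_eq0.
by exists tau => // D; apply: s_inj; rewrite tauK.
Qed.

End Isomorphism.

(** * Matching hyperplanes and transporting adjacency *)

Unset Implicit Arguments.

Theorem theorem3p6 (F : realType) (R : idomainType)
    (hR : 2%N \notin [pchar R])
    (l1 l2 : nat) (A1 : arrangement F l1) (A2 : arrangement F l2)
    (hA1 : generic_codim2 A1)
    (hVG : exists phi : VG A1 R -> VG A2 R, filtered_alg_iso phi) :
  exists f : ch A1 -> ch A2, tope_iso f.
Proof.
have two_neq0 : 2%:R != 0 :> R by move: hR; rewrite inE.
have [phi phi_iso] := hVG; have [_ _ _ fil] := phi_iso.
have [sigma [tau sK tK] phiE] := filtered_alg_iso_eval phi_iso.
have match_hyp (j : 'I_(nhyp A2)) : exists i : 'I_(nhyp A1), forall D D',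
    pos j D = pos j D' <-> pos i (sigma D) = pos i (sigma D').
  have : Fil (Posz 1) (heaviside R j) by exact: heaviside_Fil1.
  (* [g] is the preimage of the Heaviside function of [H_j]; it lies in [Fil 1] because [phi] maps
     [Fil 1] onto [Fil 1]. *)
  rewrite -fil => -[g /Fil1_affine[c [a ga]]]; rewrite phiE => gj.
  have gE D : g (sigma D) = (pos j D)%:R by rewrite -heavisideE -gj.
  have [C||i iE] := boolean_affine two_neq0 hA1 ga; last first.
  - exists i => D D'; rewrite -iE !gE; split=> [->//|]; exact: natr_bool_inj.
  - have [D [D' DD']] := wall j; exists (sigma D), (sigma D').
    by rewrite !gE => /natr_bool_inj/eqP; have := DD' j; rewrite eqxx => /negbTE->.
  - by rewrite -[C]tK gE; case: pos; [right|left].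
have /boolp.choice[p pE] := match_hyp.
have p_inj : injective p.
  (* If [p j = p j'], then [j'] also separates the two chambers that only [j] separates. *)
  move=> j j' jj'; have [D [D' DD']] := wall j.
  apply/eqP; rewrite eq_sym -DD'; apply/eqP => /pE; rewrite -jj' => /pE/eqP.
  by have := DD' j; rewrite eqxx => /negbTE ->.
have p_surj i : exists j, p j = i.
  (* If [p] missed [i], the two chambers separated by [i] alone would agree at every [p j], so their
     images under [tau] would have the same signs and coincide. *)
  apply: contrapT => nj; have [C [C' CC']] := wall i.
  have : tau C = tau C'.
    apply: pos_inj => j; apply/pE; rewrite !tK; apply/eqP.
    apply/negPn; rewrite CC'; apply/eqP => ji; case: nj; by exists j.
  move=> /(can_inj tK) CC; have := CC' i; by rewrite CC !eqxx.
have pN j D D' :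
    (pos j D != pos j D') = (pos (p j) (sigma D) != pos (p j) (sigma D')).
  by congr (~~ _); apply/eqP/eqP => /pE.
exists tau; split; first by exists sigma.
(* The bijection [p] carries the unique separating hyperplane, with its uniqueness, in both
   directions. *)
move=> C D; rewrite !tope_adjE; split=> -[i [iCD u]].
  have [j ji] := p_surj i; exists j; split=> [|k]; rewrite pN !tK ?ji//.
  by move=> /u; rewrite -ji => /p_inj.
exists (p i); split=> [|k]; first by move: iCD; rewrite pN !tK.
by have [j <-] := p_surj k; rewrite -{1}(tK C) -{1}(tK D) -pN => /u ->.
Qed.
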